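(* A graph $G$ has countably many ends if, and only if, both of the following conditions hold: (i) For every $\subseteq$-increasing sequence $(F_n:n\in\omega)$ of finite subsets of $V(G)$ there is a sequence $(C_n:n\in\omega)$, where each $C_n$ is a connected component of $G\setminus F_n$, such that every ray of $G$ has a tail in $C_n$ for some $n\in\omega$. (ii) For every ray $R$ in $G$ there exists a $\subseteq$-increasing sequence $(F_n:n\in\omega)$ of finite subsets of $V(G)$ such that, for every ray $R'$ in $G$ which is not equivalent to $R$, there exists an $n\in\omega$ such that $R$ and $R'$ have tails in different connected components of $G\setminus F_n$.
   Context: A graph is a pair $G=(V(G),E(G))$ with $V(G)$ an arbitrary set and $E(G)\subseteq [V(G)]^2$ (two-element subsets). A ray in $G$ is an injective sequence of vertices $(v_0,v_1,\dots)$ with $\{v_i,v_{i+1}\}\in E(G)$ for all $i$; a tail of it is $(v_n,v_{n+1},\dots)$ for some $n$. For finite $F\subseteq V(G)$, $G\setminus F$ is the subgraph induced on $V(G)\setminus F$. A graph is connected if every pair of distinct vertices is joined by a path (so the empty graph counts as connected); a connected component is a maximal connected subgraph. Two rays of $G$ are equivalent if for every finite $F\subseteq V(G)$ they have tails lying in the same connected component of $G\setminus F$. An end of $G$ is an equivalence class of rays. ''$\subseteq$-increasing'' means $F_n\subseteq F_{n+1}$ for all $n$ (not necessarily strictly). ''Countably many'' means at most $\aleph_0$ many. *)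

(* Defs.v *)
From mathcomp Require Import all_boot.
From mathcomp Require Import boolp classical_sets functions cardinality.

Set Implicit Arguments.
Unset Strict Implicit.
Unset Printing Implicit Defensive.

Local Open Scope classical_set_scope.

(* Vertex sets are arbitrary subsets of an arbitrary ambient type, so that the
   subgraphs of a graph are again objects of type [graph T]. *)
Record graph (T : Type) := Graph {
  vertices : set T;
  adj : T -> T -> Prop;
  adj_sym : forall x y, adj x y -> adj y x;
  adj_irr : forall x, ~ adj x x;
  adj_vertices : forall x y, adj x y -> vertices x
}.

Section Graphs.
Variable T : Type.
Implicit Types (G H : graph T) (F : set T) (R : nat -> T).

Definition subgraph H G :=
  vertices H `<=` vertices G /\ (forall x y, adj H x y -> adj G x y).

Section Delete.
Variables (G : graph T) (F : set T).

Definition delete_adj x y := [/\ adj G x y, ~ F x & ~ F y].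

Lemma delete_adj_sym x y : delete_adj x y -> delete_adj y x.
Proof. by case=> xy Fx Fy; split=> //; apply: adj_sym. Qed.

Lemma delete_adj_irr x : ~ delete_adj x x.
Proof. by move=> [xx _ _]; apply: adj_irr xx. Qed.

Lemma delete_adj_vertices x y : delete_adj x y -> (vertices G `\` F) x.
Proof. by move=> [xy Fx _]; split=> //; apply: adj_vertices xy. Qed.

Definition delete : graph T :=
  Graph delete_adj_sym delete_adj_irr delete_adj_vertices.

End Delete.

(* [p 0, ..., p n] is a path from x to y; the values of p beyond n are junk. *)
Definition joined_by_path G (x y : T) :=
  exists (n : nat) (p : nat -> T),
    [/\ p 0 = x, p n = y,
        (forall i j, i <= n -> j <= n -> p i = p j -> i = j)
      & (forall i, i < n -> adj G (p i) (p i.+1))].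

Definition connected G :=
  forall x y, vertices G x -> vertices G y -> x <> y -> joined_by_path G x y.

(* The empty graph is a component of itself, and of no other graph. *)
Definition component G H :=
  [/\ subgraph H G, connected H
    & forall H', subgraph H' G -> connected H' -> subgraph H H' ->
        subgraph H' H].

Definition ray G R :=
  injective R /\ (forall i, adj G (R i) (R i.+1)).

Definition tail_in R H := exists n, forall i, n <= i -> vertices H (R i).

Definition finite_vertex_set G F := finite_set F /\ F `<=` vertices G.

Definition ray_equiv G R R' :=
  forall F, finite_vertex_set G F ->
    exists C, [/\ component (delete G F) C, tail_in R C & tail_in R' C].

Definition ends G : set (set (nat -> T)) :=
  [set e | exists R, ray G R /\ e = [set R' | ray G R' /\ ray_equiv G R R']].

Definition increasing_finite G (F : nat -> set T) :=
  (forall n, finite_vertex_set G (F n)) /\ (forall n, F n `<=` F n.+1).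

End Graphs.

(* Main.v *)
Require Import Defs.
From mathcomp Require Import all_boot.
From mathcomp Require Import boolp classical_sets functions cardinality.

(** If there are countably many ends, both conditions follow by treating the
    [n]-th end at stage [n].

    Conversely, suppose that both conditions hold and that there are uncountably
    many ends. Call a component of [G] minus a finite set big if the rays with
    a tail in it have uncountably many ends. By selection for a constant
    sequence, only countably many components of [G] minus a finite set matter,
    so a big component still contains a big component after more vertices are
    deleted.

    The main point is that every big component can be split into two big ones
    by deleting finitely many more vertices ([big_splits]). Otherwise it
    contains exactly one big component for each larger finite set, a direction
    in the sense of Diestel and Kuehn. All rays that stay in the direction
    along a given sequence of finite sets still have uncountably many ends
    ([many_ends_inside_direction]). Consider the vertices that no finite set
    separates from the direction. If there are infinitely many, they can be
    strung on a ray that follows the direction ([core_finite]), and separation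
    of the end of this ray from all others gives a sequence of finite sets
    along which only that end remains. If there are finitely many, some
    sequence of finite sets makes the direction avoid any given vertex
    eventually, so that at most one end remains ([unsplit_absurd]).

    Splitting repeatedly yields finite sets [F n] and a binary tree of big
    components. Given any selection of one component for each [F n.+1], a branch
    of the tree can dodge all of them, since each node has two disjoint
    children. If the paths that join the components along the tree are deleted
    in time, some ray follows the branch ([ray_along_trails]) and has no tail
    in any selected component, against the first condition. *)

Local Open Scope classical_set_scope.

Set Implicit Arguments.
Unset Strict Implicit.

(** * Choice and finiteness *)

Section GeneralFacts.

(** Components are records that carry proofs; comparing two of them as graphs
    is reduced to comparing vertices and adjacency by proof irrelevance. *)
Lemma graph_ext (T : Type) (H H' : graph T) :
  vertices H = vertices H' -> adj H = adj H' -> H = H'.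
Proof.
case: H H' => [V E s i v] [V' E' s' i' v'] /= eV eE.
case: _ / eV eE v' => eE; case: _ / eE s' i' => s' i' v'.
by congr Graph; exact: Prop_irrelevance.
Qed.

(** Dependent choice with an invariant [P] that may depend on the stage: the
    stage is added to the state, and a state that violates the invariant may
    have any successor. *)
Lemma indexed_dependent_choice (X : Type) (P : nat -> X -> Prop)
    (Q : nat -> X -> X -> Prop) (x0 : X) :
    P 0 x0 ->
    (forall n x, P n x -> exists y, P n.+1 y /\ Q n x y) ->
  exists f : nat -> X, f 0 = x0 /\ forall n, P n (f n) /\ Q n (f n) (f n.+1).
Proof.
move=> P0 PQ.
pose next (nx ny : nat * X) :=
  P nx.1 nx.2 -> [/\ ny.1 = nx.1.+1, P ny.1 ny.2 & Q nx.1 nx.2 ny.2].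
have nextP nx : {ny | next nx ny}.
  apply/cid; case: nx => n x; have [Px|nPx] := pselect (P n x).
    by have [y [Py Qxy]] := PQ n x Px; exists (n.+1, y).
  by exists (0, x) => /nPx.
have [f [f0 fS]] := dependent_choice nextP (0, x0).
have fP n : (f n).1 = n /\ P n (f n).2.
  elim: n => [|n [fn Pn]]; first by rewrite f0.
  by have [] := fS n; rewrite fn // => -> Pn1 _.
exists (fun n => (f n).2); split=> [|n]; first by rewrite f0.
have [fn Pn] := fP n; split=> //.
by have [] := fS n; rewrite fn.
Qed.

Lemma finite_eventually (X : Type) (E : set X) (P : X -> nat -> Prop) :
    finite_set E ->
    (forall x, E x -> exists n, forall m, n <= m -> P x m) ->
  exists n, forall m, n <= m -> forall x, E x -> P x m.
Proof.
move=> Efin EP.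
have /choice[N NP] x : exists n, E x -> forall m, n <= m -> P x m.
  have [/EP[n nP]|nEx] := pselect (E x); first by exists n.
  by exists 0 => /nEx.
have /finite_seqP[s sE] := finite_image N Efin.
exists (\max_(i <- s) i) => m sm x Ex; apply: NP => //.
apply: leq_trans sm; apply: (@leq_bigmax_seq _ s xpredT id) => //.
by have : (N @` E) (N x) by [exists x]; rewrite sE.
Qed.

Lemma subset_chain (X : Type) (F : nat -> set X) i j :
  (forall n, F n `<=` F n.+1) -> i <= j -> F i `<=` F j.
Proof.
move=> FS /subnKC <-; elim: (j - i) => [|k IH]; first by rewrite addn0.
by rewrite addnS; apply: subset_trans IH _.
Qed.

End GeneralFacts.

(** * Connectivity and components *)

Section Connectivity.

Variables (T : Type) (G : graph T).
Implicit Types (A S E F : set T) (R : nat -> T).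

(** Connectivity inside a vertex set by walks, possibly of length 0. Walks
    concatenate freely, and taking a set instead of a subgraph makes
    monotonicity in the set available. *)
Inductive linked A : T -> T -> Prop :=
| linked_refl x : A x -> linked A x x
| linked_step x y z : A x -> adj G x y -> linked A y z -> linked A x z.

Lemma linked_left A x y : linked A x y -> A x.
Proof. by case. Qed.

Lemma linked_right A x y : linked A x y -> A y.
Proof. by elim. Qed.

Lemma linked_trans A x y z : linked A x y -> linked A y z -> linked A x z.
Proof.
by elim=> // {}x y' {}y Ax xy' _ IH /IH; apply: linked_step.
Qed.

Lemma linked_edge A x y : A x -> A y -> adj G x y -> linked A x y.
Proof. by move=> Ax Ay xy; apply: linked_step xy (linked_refl Ay). Qed.

Lemma linked_sym A x y : linked A x y -> linked A y x.
Proof.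
elim=> [z Az|z y' w Az zy' y'w wy']; first exact: linked_refl.
apply: linked_trans wy' _; apply: linked_edge (adj_sym zy') => //.
exact: linked_left y'w.
Qed.

Lemma linked_mono A S x y : A `<=` S -> linked A x y -> linked S x y.
Proof.
move=> AS; elim=> [z /AS|z y' w /AS Sz zy' _]; first exact: linked_refl.
exact: linked_step.
Qed.

(** A walk in [A] that starts at [x] only meets vertices reachable from [x], so
    the class of [x] is connected by itself. *)
Lemma linked_in_class A x y : linked A x y -> linked (linked A x) x y.
Proof.
move=> xy; have Ax := linked_left xy.
suff gen v : linked A v x -> linked (linked A v) x y.
  exact: gen (linked_refl Ax).
elim: xy {Ax} => [z Az|z y' w Az zy' y'w IH] vz; first exact: linked_refl.
apply: (linked_step vz zy' (IH (linked_trans vz _))).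
exact: linked_edge (linked_left y'w) zy'.
Qed.

(** Prepending a vertex that already occurs on a path is replaced by cutting
    the path at that occurrence, which keeps it injective. *)
Lemma linked_path A x y : linked A x y ->
  exists (n : nat) (p : nat -> T),
    [/\ p 0 = x, p n = y,
        (forall i j, i <= n -> j <= n -> p i = p j -> i = j)
      & (forall i, i < n -> adj G (p i) (p i.+1))] /\
    (forall i, i <= n -> A (p i)).
Proof.
elim=> [z Az|z y' w Az zy' _ [n [p [[p0 pn pinj padj] pA]]]].
  by exists 0, (fun=> z); split=> //; split=> // -[|i] [|j].
have [[k [kn pk]]|zp] := pselect (exists k, k <= n /\ p k = z).
  exists (n - k), (fun i => p (k + i)); split; first split.
  - by rewrite addn0.
  - by rewrite subnKC.
  - move=> i j ik jk /pinj; rewrite -!leq_subRL // => /(_ ik jk).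
    exact: addnI.
  - by move=> i ik; rewrite addnS; apply: padj; rewrite -ltn_subRL.
  - by move=> i ik; apply: pA; rewrite -leq_subRL.
exists n.+1, (fun i => if i is j.+1 then p j else z); split; first split=> //.
- move=> [|i] [|j] //= ijn jin pij.
  + by case: zp; exists j.
  + by case: zp; exists i.
  + by congr _.+1; apply: pinj.
- by move=> [|i] /=; [rewrite p0|exact: padj].
- by move=> [|i] //=; exact: pA.
Qed.

(** The vertices of [delete G F], as a set on which [linked] can be used. *)
Definition off F := vertices G `\` F.

Lemma off_mono E F : E `<=` F -> off F `<=` off E.
Proof. by move=> EF x [Vx nFx]; split=> // /EF. Qed.

Definition class_adj F x y z :=
  [/\ adj G y z, linked (off F) x y & linked (off F) x z].

Lemma class_adj_sym F x y z : class_adj F x y z -> class_adj F x z y.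
Proof. by case=> yz xy xz; split=> //; exact: adj_sym. Qed.

Lemma class_adj_irr F x y : ~ class_adj F x y y.
Proof. by case=> yy _ _; exact: adj_irr yy. Qed.

Lemma class_adj_vertices F x y z : class_adj F x y z -> linked (off F) x y.
Proof. by case. Qed.

Definition class_graph F x : graph T :=
  Graph (@class_adj_sym F x) (@class_adj_irr F x) (@class_adj_vertices F x).

Lemma subgraph_connected_class F x H :
    subgraph H (delete G F) -> connected H -> vertices H x ->
  subgraph H (class_graph F x).
Proof.
move=> [HV Hadj] Hconn Hx.
have Hlinked y : vertices H y -> linked (off F) x y.
  move=> Hy; have [<-|xy] := pselect (x = y); first exact/linked_refl/HV.
  have [n [p [p0 pn _ padj]]] := Hconn x y Hx Hy xy.
  rewrite -pn -p0; elim: n {pn} padj => [_|n IH padj].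
    by apply: linked_refl; rewrite p0; apply: HV.
  apply: linked_trans (IH _) _ => [i /ltnW|]; first exact: padj.
  have [pnS nFn nFnS] := Hadj _ _ (padj n (leqnn _)).
  apply: linked_edge (pnS); split=> //; first exact: adj_vertices pnS.
  exact: adj_vertices (adj_sym pnS).
split=> [y /Hlinked//|y z yz].
split; [by have [] := Hadj _ _ yz| |]; apply: Hlinked.
  exact: adj_vertices yz.
exact: adj_vertices (adj_sym yz).
Qed.

Lemma class_graph_component F x :
  off F x -> component (delete G F) (class_graph F x).
Proof.
move=> Fx; split.
- split=> [y /linked_right//|y z [yz xy xz]]; split=> //.
    by case: (linked_right xy).
  by case: (linked_right xz).
- move=> y z xy xz _.
  have yz := linked_trans (linked_sym xy) xz.
  have [n [p [[p0 pn pinj padj] pA]]] := linked_path (linked_in_class yz).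
  exists n, p; split=> // i ni; split; first exact: padj.
    by apply: linked_trans xy _; apply/pA/ltnW.
  by apply: linked_trans xy _; apply: pA.
move=> H HF Hconn [xH _]; apply: subgraph_connected_class HF Hconn _.
exact/xH/linked_refl.
Qed.

(** Components are determined by any of their vertices: this turns statements
    about arbitrary components into statements about [linked]. *)
Lemma component_classE F x C :
  component (delete G F) C -> vertices C x -> C = class_graph F x.
Proof.
move=> [CF Cconn Cmax] Cx.
have Csub := subgraph_connected_class CF Cconn Cx.
have [|clF clconn _] := @class_graph_component F x; first exact: CF.1.
have [clV clE] := Cmax _ clF clconn Csub.
apply: graph_ext; first by rewrite eqEsubset; split=> //; apply: Csub.1.
apply/funext => y; apply/funext => z; apply/propext.
by split=> [/Csub.2|/clE].
Qed.

Lemma component_exists F : exists C, component (delete G F) C.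
Proof.
have [[x Fx]|noF] := pselect (off F !=set0).
  by exists (class_graph F x); exact: class_graph_component.
have noV x : ~ off F x by move=> Fx; apply: noF; exists x.
exists (delete G F); split=> //; by [split|move=> x y /noV].
Qed.

(** * Rays that follow a chain of finite connected sets *)

(** A finite set [S] in which every vertex can move towards [b]: the potential
    [d] decreases along some edge of [S]. Compared with an explicit path, this
    form has no order of vertices to keep track of, so a ray can enter a trail
    at any vertex and leave it at any vertex. *)
Definition trail S a b :=
  [/\ finite_set S, S a, S b & exists d : T -> nat,
    forall z, S z -> z <> b -> exists z', [/\ S z', adj G z z' & d z' < d z]].

Lemma linked_trail A x y : linked A x y -> exists S, S `<=` A /\ trail S x y.
Proof.
elim=> [z Az|z y' w Az zy' _ [S [SA [Sfin Sy' Sw [d dP]]]]].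
  exists [set z]; split=> [_ -> //|]; split; [exact: finite_set1|by []|by []|].
  by exists (fun=> 0) => _ -> [].
have [Sz|nSz] := pselect (S z).
  by exists S; split=> //; split=> //; exists d.
exists (z |` S); split=> [_ [->|/SA]//|]; split; [|by left|by right|].
  by rewrite finite_setU; split=> //; exact: finite_set1.
have neq u : S u -> u <> z by move=> Su uz; apply: nSz; rewrite -uz.
exists (fun u => if `[< u = z >] then (d y').+1 else d u) => u [->{u}|Su] uw.
  exists y'; split=> //; first by right.
  by rewrite /= (asboolF (neq _ Sy')) asboolT.
have [u' [Su' uu' du']] := dP u Su uw.
exists u'; split=> //; first by right.
by rewrite /= (asboolF (neq _ Su)) (asboolF (neq _ Su')).
Qed.

Lemma trail_linked S a b z : trail S a b -> S z -> linked S z b.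
Proof.
move=> [_ _ Sb [d dP]]; have [n] := ubnP (d z); elim: n z => // n IH z dzn Sz.
have [->|zb] := pselect (z = b); first exact: linked_refl.
have [z' [Sz' zz' dz']] := dP z Sz zb.
by apply: linked_step Sz zz' (IH _ _ Sz'); apply: leq_trans dz' _.
Qed.

(** Suppose that a trail leads from each [v n] to [v n.+1] and that
    non-consecutive trails are disjoint. Each vertex of their union then lies
    in a last trail [S n]. Moving from it to a neighbour of smaller potential in
    [S n] either keeps the index of the last trail and lowers the potential, or
    raises the index. Hence the walk never returns to a vertex, so it is a ray,
    and the index tends to infinity since potentials cannot drop forever. *)
Lemma ray_along_trails (v : nat -> T) (S : nat -> set T) :
    (forall n, trail (S n) (v n) (v n.+1)) ->
    (forall n m x, n.+2 <= m -> S n x -> ~ S m x) ->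
  exists R, ray G R /\
    forall n, exists N, forall i, N <= i -> exists m, n <= m /\ S m (R i).
Proof.
move=> Strail Sdisj.
have /choice[d dP] n : exists d : T -> nat, forall z, S n z -> z <> v n.+1 ->
    exists z', [/\ S n z', adj G z z' & d z' < d z] by case: (Strail n).
pose at_last (nx : nat * T) := S nx.1 nx.2 /\ ~ S nx.1.+1 nx.2.
pose next (nx ny : nat * T) := at_last nx ->
  [/\ at_last ny, adj G nx.2 ny.2 & ny.1 = nx.1.+1 \/
      ny.1 = nx.1 /\ d nx.1 ny.2 < d nx.1 nx.2].
have nextP nx : {ny | next nx ny}.
  apply/cid; case: nx => n x.
  have [[/= Sx nSx]|no] := pselect (at_last (n, x)); last by exists (n, x).
  (* The end of the n-th trail also lies in the next one, so x is not it. *)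
  have [|z [Sz xz dz]] := dP n x Sx.
    by move=> xv; apply: nSx; rewrite xv; case: (Strail n.+1).
  have [Sz1|nSz1] := pselect (S n.+1 z).
    exists (n.+1, z) => _; split; [split=> //=|by []|by left].
    exact: Sdisj Sz.
  by exists (n, z) => _; split; [split|by []|right].
have [nx0 nx0P] : exists nx, at_last nx.
  have [S1|nS1] := pselect (S 1 (v 0)).
    exists (1, v 0); split=> //=; apply: Sdisj; first exact: leqnn.
    by case: (Strail 0).
  by exists (0, v 0); split=> //; case: (Strail 0).
have [f [f0 fS]] := dependent_choice nextP nx0.
have flast k : at_last (f k).
  by elim: k => [|k /fS[]//]; rewrite f0.
have fstep k := fS k (flast k).
have last_uniq nx ny : at_last nx -> at_last ny -> nx.2 = ny.2 -> nx.1 = ny.1.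
  case: nx ny => [n x] [m y] [/= Snx nSnx] [/= Smy nSmy] /= xy.
  rewrite -{}xy in Smy nSmy.
  have nlt a b : S a x -> ~ S a.+1 x -> S b x -> ~ a < b.
    move=> Sa nSa Sb; rewrite leq_eqVlt => /orP[/eqP ab|ab].
      by apply: nSa; rewrite ab.
    exact: Sdisj ab Sa Sb.
  by case: (ltngtP n m) => // [/nlt|/nlt] [].
have fprogress i j : i < j -> (f i).1 < (f j).1 \/
    (f i).1 = (f j).1 /\ d (f i).1 (f j).2 < d (f i).1 (f i).2.
  elim: j => // j IH; rewrite ltnS leq_eqVlt => /orP[/eqP->|/IH{IH} ij].
    by have [_ _ [->|[-> ?]]] := fstep j; [left|right].
  have [_ _ [->|[-> dj]]] := fstep j; first by left; case: ij => [/ltnW|[->]].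
  case: ij => [|[ij dij]]; [by left|right; split=> //].
  by rewrite ij (ltn_trans dj) // -ij.
have fmono i j : i <= j -> (f i).1 <= (f j).1.
  rewrite leq_eqVlt => /orP[/eqP->//|/fprogress[/ltnW//|[->//]]].
have flarge n : exists k, n <= (f k).1.
  elim: n => [|n [k nk]]; first by exists 0.
  have [b] := ubnP (d (f k).1 (f k).2); elim: b k nk => // b IH k nk db.
  have [_ _ [fk|[fk dk]]] := fstep k; first by exists k.+1; rewrite fk ltnS.
  by apply: (IH k.+1); rewrite fk //; apply: leq_trans dk _.
exists (fun k => (f k).2); split; first split.
- have neq i j : i < j -> (f i).2 <> (f j).2.
    move=> /fprogress ij fij; have := last_uniq _ _ (flast i) (flast j) fij.
    by case: ij => [+ e|[_ + _]]; rewrite ?e ?fij ltnn.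
  by move=> i j; case: (ltngtP i j) => // /neq // + /esym.
- by move=> k; have [] := fstep k.
move=> n; have [k nk] := flarge n; exists k => i ki; exists (f i).1.
by split; [exact: leq_trans nk (fmono _ _ ki)|exact: (flast i).1].
Qed.

(** * Tails of rays, ends and their equivalence *)

Lemma ray_avoids R E : ray G R -> finite_set E ->
  exists n, forall i, n <= i -> ~ E (R i).
Proof.
move=> [Rinj _] Efin.
have [x Ex|n nP] := @finite_eventually T E (fun x i => R i <> x) Efin.
  have [[k kx]|no] := pselect (exists k, R k = x).
    exists k.+1 => i ki Rix; move: ki.
    by rewrite (Rinj i k) ?ltnn // Rix kx.
  by exists 0 => i _ Rix; apply: no; exists i.
by exists n => i ni ER; exact: nP ni _ ER _.
Qed.

Lemma ray_vertices R i : ray G R -> vertices G (R i).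
Proof. by move=> [_ /(_ i)]; exact: adj_vertices. Qed.

Lemma ray_tail_linked R F : ray G R -> finite_set F ->
  exists n, forall i, n <= i -> linked (off F) (R n) (R i).
Proof.
move=> rayR Ffin; have [n nP] := ray_avoids rayR Ffin; exists n.
have Roff i : n <= i -> off F (R i).
  by move=> /nP; split=> //; exact: ray_vertices.
move=> i ni; rewrite -(subnKC ni); elim: (i - n) => [|k IH].
  by rewrite addn0; apply/linked_refl/Roff.
have nk : n <= n + k by exact: leq_addr.
rewrite addnS; apply: linked_trans IH _.
exact: linked_edge (Roff _ nk) (Roff _ (leqW nk)) (rayR.2 _).
Qed.

Lemma ray_component R F : ray G R -> finite_set F ->
  exists x, off F x /\ tail_in R (class_graph F x).
Proof.
move=> rayR Ffin; have [n nP] := ray_tail_linked rayR Ffin.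
exists (R n); split; [exact: linked_left (nP _ (leqnn n))|by exists n].
Qed.

Lemma tail_in_class_linked R F x y :
  tail_in R (class_graph F x) -> tail_in R (class_graph F y) ->
  linked (off F) x y.
Proof.
move=> [m xR] [n yR]; apply: linked_trans (xR (maxn m n) (leq_maxl m n)) _.
exact/linked_sym/yR/leq_maxr.
Qed.

Lemma tail_in_component_uniq R F C C' :
  component (delete G F) C -> component (delete G F) C' ->
  tail_in R C -> tail_in R C' -> C = C'.
Proof.
move=> CF C'F [m CR] [n C'R]; have := CR _ (leq_maxl m n).
move=> /(component_classE CF) ->.
by have := C'R _ (leq_maxr m n) => /(component_classE C'F) ->.
Qed.

Lemma ray_equiv_refl R : ray G R -> ray_equiv G R R.
Proof.
move=> rayR F [Ffin _]; have [x [Fx xR]] := ray_component rayR Ffin.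
by exists (class_graph F x); split=> //; exact: class_graph_component.
Qed.

Lemma ray_equiv_sym R R' : ray_equiv G R R' -> ray_equiv G R' R.
Proof. by move=> RR' F /RR'[C [? ? ?]]; exists C. Qed.

Lemma ray_equiv_trans R R' R'' :
  ray_equiv G R R' -> ray_equiv G R' R'' -> ray_equiv G R R''.
Proof.
move=> RR' R'R'' F Ffin.
have [C [CF CR CR']] := RR' F Ffin; have [C' [C'F C'R' C'R'']] := R'R'' F Ffin.
by exists C; split=> //; rewrite (tail_in_component_uniq CF C'F CR' C'R').
Qed.

Lemma tail_in_equiv R R' F C : finite_vertex_set G F ->
  component (delete G F) C -> ray_equiv G R R' -> tail_in R C -> tail_in R' C.
Proof.
move=> Ffin CF RR' CR; have [C' [C'F C'R C'R']] := RR' F Ffin.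
by rewrite (tail_in_component_uniq CF C'F CR C'R).
Qed.

Definition end_of R : set (nat -> T) := [set R' | ray G R' /\ ray_equiv G R R'].

Lemma end_of_eq R R' : ray_equiv G R R' -> end_of R = end_of R'.
Proof.
move=> RR'; rewrite eqEsubset; split=> Q [rayQ RQ]; split=> //.
  exact: ray_equiv_trans (ray_equiv_sym RR') RQ.
exact: ray_equiv_trans RR' RQ.
Qed.

Lemma end_of_inj R R' : ray G R' -> end_of R = end_of R' -> ray_equiv G R R'.
Proof.
move=> rayR' e; have : end_of R' R' by split=> //; exact: ray_equiv_refl.
by rewrite -e => -[].
Qed.

Lemma endsE : ends G = end_of @` ray G.
Proof.
rewrite eqEsubset; split=> [e [R [rayR ->]]|e [R rayR <-]]; by exists R.
Qed.

Lemma finite_vertex_setU E F :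
  finite_vertex_set G E -> finite_vertex_set G F ->
  finite_vertex_set G (E `|` F).
Proof.
move=> [Efin EV] [Ffin FV]; split; first by rewrite finite_setU.
by rewrite subUset.
Qed.

Lemma finite_vertex_set_bigcup (I : Type) (D : set I) (F : I -> set T) :
  finite_set D -> (forall i, D i -> finite_vertex_set G (F i)) ->
  finite_vertex_set G (\bigcup_(i in D) F i).
Proof.
move=> Dfin DF; split; first by apply: bigcup_finite => // i /DF[].
by move=> x [i /DF[_ FV] /FV].
Qed.

Lemma not_equiv_separated R R' : ray G R -> ray G R' -> ~ ray_equiv G R R' ->
  exists2 F, finite_vertex_set G F &
    forall C, component (delete G F) C -> tail_in R C -> ~ tail_in R' C.
Proof.
move=> rayR rayR' /existsNP[F /not_implyP[FV noC]]; exists F => // C CF CR CR'.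
by apply: noC; exists C.
Qed.

Lemma linked_component F C x y : component (delete G F) C ->
  vertices C x -> linked (off F) x y -> vertices C y.
Proof. by move=> CF /(component_classE CF) ->. Qed.

(** * Countably many ends imply both conditions *)

Definition component_selection :=
  forall F : nat -> set T, increasing_finite G F ->
    exists C : nat -> graph T,
      (forall n, component (delete G (F n)) (C n)) /\
      (forall R, ray G R -> exists n, tail_in R (C n)).

Definition end_separation :=
  forall R, ray G R ->
    exists F : nat -> set T, increasing_finite G F /\
      (forall R', ray G R' -> ~ ray_equiv G R R' ->
        exists n, exists C C' : graph T,
          [/\ component (delete G (F n)) C, component (delete G (F n)) C',
              C <> C', tail_in R C & tail_in R' C']).

Lemma countable_ends_index : countable (ends G) ->
  exists f : (nat -> T) -> nat,
    forall R R', ray G R -> ray G R' -> f R = f R' -> ray_equiv G R R'.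
Proof.
move=> /countable_injP[f finj]; exists (f \o end_of) => R R' rayR rayR' ff.
have endR Q : ray G Q -> end_of Q \in ends G.
  by move=> rayQ; rewrite inE endsE; exists Q.
by apply: end_of_inj => //; apply: finj ff; exact: endR.
Qed.

(** List the ends; the component chosen at stage [n] is the one that contains
    the tails of the rays of the [n]-th end. *)
Lemma countable_ends_selection : countable (ends G) -> component_selection.
Proof.
move=> /countable_ends_index[f fequiv] F [Ffin _].
have /choice[C CP] n : exists C, component (delete G (F n)) C /\
    forall R, ray G R -> f R = n -> tail_in R C.
  have [[R0 [rayR0 fR0]]|no] := pselect (exists R, ray G R /\ f R = n).
    have [x [Fx xR0]] := ray_component rayR0 (Ffin n).1.
    have xF := class_graph_component Fx.
    exists (class_graph (F n) x); split=> // R rayR fR.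
    apply: tail_in_equiv (Ffin n) xF _ xR0; apply: fequiv => //.
    by rewrite fR0 fR.
  have [C CF] := component_exists (F n); exists C; split=> // R rayR fR.
  by case: no; exists R.
exists C; split=> [n|R rayR]; first exact: (CP n).1.
by exists (f R); apply: (CP (f R)).2.
Qed.

(** List the ends; [E n] separates [R] from the [n]-th end, and the union of
    the first [n.+1] of these sets separates at least as much. *)
Lemma countable_ends_separation : countable (ends G) -> end_separation.
Proof.
move=> /countable_ends_index[f fequiv] R rayR.
have /choice[E EP] n : exists E, finite_vertex_set G E /\
    forall R', ray G R' -> f R' = n -> ~ ray_equiv G R R' ->
      forall C, component (delete G E) C -> tail_in R C -> ~ tail_in R' C.
  have [[R0 [rayR0 fR0 RR0]]|no] := pselect (exists R', [/\ ray G R', f R' = n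
      & ~ ray_equiv G R R']); last first.
    exists set0; split=> [|R' rayR' fR' RR'].
      by split=> //; exact: finite_set0.
    by case: no; exists R'.
  have [E EV Esep] := not_equiv_separated rayR rayR0 RR0; exists E; split=> //.
  move=> R' rayR' fR' _ C CE CR CR'; apply: (Esep C) => //.
  by apply: tail_in_equiv EV CE _ CR'; apply: fequiv; rewrite ?fR' ?fR0.
pose F n := \bigcup_(i in `I_n.+1) E i.
have FV n : finite_vertex_set G (F n).
  apply: finite_vertex_set_bigcup => [|i _]; first exact: finite_II.
  exact: (EP i).1.
exists F; split.
  by split=> // n x [i /= ni Eix]; exists i => //=; exact: leqW.
move=> R' rayR' RR'; exists (f R'); set n := f R'.
have [x [Fx xR]] := ray_component rayR (FV n).1.
have [y [Fy yR']] := ray_component rayR' (FV n).1.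
exists (class_graph (F n) x), (class_graph (F n) y).
split=> //; [exact: class_graph_component|exact: class_graph_component|].
move=> xy; have EF : off (F n) `<=` off (E n).
  by apply: off_mono => z Ez; exists n => //=.
apply: ((EP n).2 R' rayR' erefl RR' (class_graph (E n) x)).
- exact/class_graph_component/EF.
- by have [m mR] := xR; exists m => i /mR; exact: linked_mono.
- rewrite -xy in yR'; have [m mR'] := yR'.
  by exists m => i /mR'; exact: linked_mono.
Qed.

(** * Big components *)

Definition few_ends (A : set (nat -> T)) := countable (end_of @` A).

Lemma few_ends_sub (A B : set (nat -> T)) :
  A `<=` B -> few_ends B -> few_ends A.
Proof.
move=> AB; apply: sub_countable; apply: subset_card_le.
exact: image_subset AB.
Qed.

Lemma few_ends_bigcup (A : nat -> set (nat -> T)) :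
  (forall n, few_ends (A n)) -> few_ends (\bigcup_n A n).
Proof.
move=> Afew; rewrite /few_ends image_bigcup.
by apply: bigcup_countable => [|n _]; [exact: countableP|exact: Afew].
Qed.

(** Pairwise equivalent rays belong to one end at most. *)
Lemma few_ends_equiv (A : set (nat -> T)) :
  (forall R R', A R -> A R' -> ray_equiv G R R') -> few_ends A.
Proof.
move=> Aequiv; have [[R AR]|noA] := pselect (A !=set0).
  apply: (sub_countable (subset_card_le _) (countable1 (end_of R))).
  by move=> e [R' AR' <-]; exact/esym/end_of_eq/Aequiv.
have -> : A = set0 by rewrite eqEsubset; split=> // R AR; case: noA; exists R.
by rewrite /few_ends image_set0; exact: countable0.
Qed.

Lemma not_few_nonempty (A : set (nat -> T)) : ~ few_ends A -> A !=set0.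
Proof.
move=> Abig; apply: contrapT => noA; apply/Abig/few_ends_equiv => R R' AR.
by case: noA; exists R.
Qed.

Definition rays_in F x : set (nat -> T) :=
  [set R | ray G R /\ tail_in R (class_graph F x)].

(** A component of [delete G F] is represented by one of its vertices. *)
Definition big F x := ~ few_ends (rays_in F x).

Lemma big_off F x : big F x -> off F x.
Proof.
by move=> /not_few_nonempty[R [_ [n /(_ n (leqnn n))]]]; exact: linked_left.
Qed.

Lemma rays_in_linked F F' x y : F `<=` F' -> linked (off F) x y ->
  rays_in F' y `<=` rays_in F x.
Proof.
move=> FF' xy R [rayR [n yR]]; split=> //; exists n => i /yR yRi.
exact: linked_trans xy (linked_mono (off_mono FF') yRi).
Qed.

Lemma big_linked F x y : linked (off F) x y -> big F x -> big F y.
Proof.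
move=> xy; apply/contra_not/few_ends_sub/rays_in_linked => //.
exact: linked_sym.
Qed.

Lemma big_mono F F' x : off F' x -> F `<=` F' -> big F' x -> big F x.
Proof.
move=> F'x FF'; apply/contra_not/few_ends_sub/rays_in_linked => //.
exact/linked_refl/(off_mono FF').
Qed.

Section Uncountable.

Hypotheses (sel : component_selection) (sep : end_separation).

(** Selection for a constant sequence says that countably many components of
    [delete G F] contain tails of all rays, so one of them must contain tails
    of uncountably many inequivalent rays of [A]. *)
Lemma not_few_big F (A : set (nat -> T)) :
  finite_vertex_set G F -> A `<=` ray G -> ~ few_ends A ->
  exists y, ~ few_ends (A `&` rays_in F y).
Proof.
move=> FV Aray; apply: contra_notP => /forallNP Afew.
have Fincr : increasing_finite G (fun=> F) by split=> n; [exact: FV|].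
have [C [CF CR]] := sel Fincr.
apply: (@few_ends_sub _ (\bigcup_n (A `&` [set R | tail_in R (C n)]))).
  by move=> R AR; have [n CnR] := CR R (Aray R AR); exists n.
apply: few_ends_bigcup => n.
have [[y Cy]|noC] := pselect (vertices (C n) !=set0).
  apply: few_ends_sub (contrapT (Afew y)) => R [AR CnR]; split=> //.
  by split; [exact: Aray|rewrite -(component_classE (CF n) Cy)].
apply: few_ends_equiv => R R' [_ [m Cm]].
by case: noC; exists (R m); exact: Cm.
Qed.

Lemma big_refine F F' x : finite_vertex_set G F' -> F `<=` F' -> big F x ->
  exists y, linked (off F) x y /\ big F' y.
Proof.
move=> F'V FF' Fx.
have [y ybig] := not_few_big F'V (fun R (xR : rays_in F x R) => xR.1) Fx.
exists y; split; last exact: contra_not (few_ends_sub (@subIsetr _ _ _)) ybig.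
have [R [[_ xR] [rayR yR]]] := not_few_nonempty ybig.
apply: tail_in_class_linked xR _; have [n yRn] := yR; exists n => i /yRn.
exact/linked_mono/off_mono.
Qed.

(** * Every big component splits *)

(** In this section a big component, that of [x] after deleting [F], is assumed
    to contain only one big component of [delete G F'] for every larger finite
    [F']. These components [direction F'] shrink as [F'] grows, so they form a
    direction of the graph. The aim is a contradiction: the direction is either
    followed by a ray, which separation excludes, or eventually avoids every
    vertex along a suitable sequence, which leaves room for one end only. *)
Section Unsplit.

Variables (F : set T) (x : T).

Definition admissible F' := finite_vertex_set G F' /\ F `<=` F'.

Hypotheses (FV : finite_vertex_set G F) (Fbig : big F x)
  (unsplit : forall F' y z, admissible F' ->
     linked (off F) x y -> linked (off F) x z ->
     big F' y -> big F' z -> linked (off F') y z).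

Definition direction F' : set T := [set y | linked (off F) x y /\ big F' y].

Definition eventually_in (A : set T) R := exists n, forall i, n <= i -> A (R i).

Lemma direction_nonempty F' : admissible F' -> direction F' !=set0.
Proof. by move=> [F'V FF']; have [y] := big_refine F'V FF' Fbig; exists y. Qed.

Lemma direction_linked F' y z : admissible F' ->
  linked (off F') y z -> direction F' y -> direction F' z.
Proof.
move=> [_ FF'] yz [xy ybig]; split; last exact: big_linked yz ybig.
exact: linked_trans xy (linked_mono (off_mono FF') yz).
Qed.

Lemma direction_class F' y z : admissible F' ->
  direction F' y -> direction F' z -> linked (off F') y z.
Proof. by move=> F'adm [xy ybig] [xz zbig]; exact: unsplit. Qed.

Lemma direction_off F' y : direction F' y -> off F' y.
Proof. by case=> _ /big_off. Qed.

Lemma direction_mono F' F'' : F' `<=` F'' -> direction F'' `<=` direction F'.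
Proof.
move=> FF y [xy ybig]; split=> //.
exact: big_mono (big_off ybig) FF ybig.
Qed.

Lemma few_ends_outside_direction F' : admissible F' ->
  few_ends [set R | rays_in F x R /\ ~ eventually_in (direction F') R].
Proof.
move=> F'adm; apply: contrapT => /(not_few_big F'adm.1)[R [[]//]|y ybig].
have [R [[[_ xR] RF'] [rayR yR]]] := not_few_nonempty ybig.
apply: RF'; have [m xRm] := xR; have [n yRn] := yR.
have F'y : big F' y by apply: contra_not (few_ends_sub (@subIsetr _ _ _)) ybig.
exists (maxn m n) => i; rewrite geq_max => /andP[mi ni].
by split; [exact: xRm|exact: big_linked (yRn _ ni) F'y].
Qed.

(** For each [n] the rays that leave [direction (X n)] have few ends, hence so
    do those that leave it for some [n]. *)
Lemma many_ends_inside_direction (X : nat -> set T) :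
  (forall n, admissible (X n)) ->
  ~ few_ends [set R |
      rays_in F x R /\ forall n, eventually_in (direction (X n)) R].
Proof.
move=> Xadm few; apply: Fbig.
pose A n := if n is k.+1 then
  [set R | rays_in F x R /\ ~ eventually_in (direction (X k)) R] else
  [set R | rays_in F x R /\ forall n, eventually_in (direction (X n)) R].
apply: (@few_ends_sub _ (\bigcup_n A n)) => [R xR|].
  have [|] := pselect (forall n, eventually_in (direction (X n)) R).
    by exists 0.
  by move=> /existsNP[n nR]; exists n.+1.
by apply: few_ends_bigcup => -[|n] //=; apply: few_ends_outside_direction.
Qed.

(** Apply separation to such a ray [R]. With [F] added to them, the separating
    sets are among those that define the direction, so a ray that stays in all
    of the corresponding components cannot be separated from [R]; but there
    are uncountably many ends of such rays. *)
Lemma no_ray_follows_direction R : ray G R ->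
  ~ (forall F', admissible F' -> eventually_in (direction F') R).
Proof.
move=> rayR Rdir; have [E [[EV _] Esep]] := sep rayR.
have Xadm n : admissible (E n `|` F).
  by split; [exact: finite_vertex_setU|exact: subsetUr].
apply: (many_ends_inside_direction Xadm).
have Requiv R' :
    rays_in F x R' /\ (forall n, eventually_in (direction (E n `|` F)) R') ->
    ray_equiv G R R'.
  move=> [[rayR' _] R'dir]; apply: contrapT => /(Esep R' rayR').
  move=> [n [C [C' [CE C'E CC' CR C'R']]]]; apply: CC'.
  have [m Rm] := Rdir _ (Xadm n); have [m' R'm'] := R'dir n.
  have [k Ck] := CR; have [k' C'k'] := C'R'.
  set i := maxn m k; set i' := maxn m' k'.
  have Ri := Rm i (leq_maxl _ _); have R'i' := R'm' i' (leq_maxl _ _).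
  have ii' : linked (off (E n)) (R i) (R' i').
    apply: linked_mono (off_mono (@subsetUl _ (E n) F)) _.
    exact: direction_class.
  have CR' := linked_component CE (Ck i (leq_maxr _ _)) ii'.
  have C'R'i' := C'k' i' (leq_maxr _ _).
  by rewrite (component_classE CE CR') -(component_classE C'E C'R'i').
apply: few_ends_equiv => Q Q' /Requiv RQ /Requiv.
exact: ray_equiv_trans (ray_equiv_sym RQ).
Qed.

(** The vertices that no finite set containing [F] and avoiding them separates
    from the direction. *)
Definition core : set T :=
  [set v | vertices G v /\
    forall F', admissible F' -> ~ F' v -> direction F' v].

(** Any two vertices of the core lie together in [direction F'] as long as
    [F'] avoids them, so they are joined by a path outside [F']. If the core is
    infinite, fresh core vertices can be joined successively by trails that
    avoid all earlier ones, except for shared ends. The ray along these trails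
    follows the direction: a finite set meets only finitely many trails, and
    every other trail is a connected set that contains a core vertex. *)
Lemma core_finite : finite_set core.
Proof.
apply: contrapT => Kinf.
have fresh U : finite_set U -> exists v, core v /\ ~ U v.
  by move=> /(infinite_setD Kinf)/infinite_setN0[v []]; exists v.
(* The state is the set of vertices used so far, without the current core
   vertex, and the current core vertex. *)
pose P (n : nat) (Uv : set T * T) :=
  [/\ finite_vertex_set G Uv.1, core Uv.2, ~ Uv.1 Uv.2 & ~ F Uv.2].
pose Q (n : nat) (Uv Uv' : set T * T) := exists S,
  [/\ trail S Uv.2 Uv'.2, S `<=` off Uv.1, S `\ Uv'.2 `<=` Uv'.1,
      Uv.1 `<=` Uv'.1 & Uv.2 <> Uv'.2].
have [v0 [Kv0 Fv0]] := fresh F FV.1.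
have [|n [U v] [/= UV Kv Uv Fv]|f [_ fPQ]] :=
    @indexed_dependent_choice _ P Q (set0, v0).
- by split=> //; split=> //; exact: finite_set0.
- have UFadm : admissible (U `|` F).
    by split; [exact: finite_vertex_setU|exact: subsetUr].
  have UvV : finite_vertex_set G (U `|` F `|` [set v]).
    apply: finite_vertex_setU; first exact: UFadm.1.
    by split; [exact: finite_set1|move=> _ ->; exact: Kv.1].
  have [w [Kw UFvw]] := fresh _ UvV.1.
  have UFw : ~ (U `|` F) w by move=> UFw; apply: UFvw; left.
  have vw : linked (off (U `|` F)) v w.
    have mv := Kv.2 _ UFadm (fun UF => or_ind Uv Fv UF).
    have mw := Kw.2 _ UFadm UFw.
    exact: direction_class UFadm mv mw.
  have [S [SUF Strail]] := linked_trail vw.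
  exists (U `|` S `\ w, w); split.
    split=> //=; last by move=> Fw; apply: UFw; right.
      split; last by rewrite subUset; split; [exact: UV.2|move=> z [/SUF[]]].
      rewrite finite_setU; split; first exact: UV.1.
      by apply: (@sub_finite_set _ _ S); [exact: subDsetl|case: Strail].
    by case=> [Uw|[_]]; [apply: UFw; left|exact].
  exists S; split=> //=.
  - by apply: subset_trans SUF _; apply/off_mono/subsetUl.
  - by move=> vw'; apply: UFvw; right.
have /choice[S SP] n := (fPQ n).2.
pose U n := (f n).1; pose v n := (f n).2.
have UU i j : i <= j -> U i `<=` U j.
  by apply: subset_chain => n; case: (SP n).
have Strail n : trail (S n) (v n) (v n.+1) by case: (SP n).
have Soff n : S n `<=` off (U n) by case: (SP n).
have Sdisj n m z : n.+2 <= m -> S n z -> ~ S m z.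
  move=> nm Sz /Soff[_]; apply; apply: (UU _ _ nm).
  (* The common vertex of two consecutive trails becomes used one stage after
     the other vertices of the first trail. *)
  have [zv|zv] := pselect (z = v n.+1).
    have [_ _ US _ vv] := SP n.+1; apply: US; split; last by rewrite /= zv.
    by rewrite zv; case: (Strail n.+1).
  have [_ _ US _ _] := SP n; apply: (UU n.+1 n.+2) => //.
  exact: US.
have [R [rayR RS]] := ray_along_trails Strail Sdisj.
apply: (no_ray_follows_direction rayR) => F' F'adm.
have [e F'e|n0 n0P] := finite_eventually (P := fun e m => ~ S m e) F'adm.1.1.
  have [[k Ske]|no] := pselect (exists k, S k e).
    by exists k.+2 => m km; exact: Sdisj Ske.
  by exists 0 => m _ Sme; apply: no; exists m.
have [N NP] := RS n0; exists N => i /NP[m [n0m SRi]].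
have SF' : S m `<=` off F'.
  by move=> z Sz; split; [case: (Soff _ _ Sz)|move=> F'z; exact: (n0P _ n0m z)].
have [_ _ Sv _] := Strail m.
apply: (@direction_linked F' (v m.+1)) => //.
  exact: linked_sym (linked_mono SF' (trail_linked (Strail m) SRi)).
have [[_ [_ Kv] _ _] _] := fPQ m.+1; apply: Kv => //.
by case: (SF' _ Sv).
Qed.

(** Each [v] in [X] outside the core is cut off from the direction by some
    finite set [Y v] that avoids [v]; then [v] has no neighbour in
    [direction (Y v)]. Taking the union of the [Y v] treats all of [X] at once.
    A vertex of [direction X] is added as well, so that the direction strictly
    shrinks. *)
Lemma direction_separate X : admissible X -> core `<=` X ->
  exists X', [/\ admissible X', X `<=` X', direction X `&` X' !=set0
    & forall v w, X v -> ~ core v -> direction X' w -> ~ adj G v w].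
Proof.
move=> [XV FX] KX.
have /choice[Y YP] v : exists Y, admissible Y /\
    (X v -> ~ core v -> ~ Y v /\ ~ direction Y v).
  have [[Xv Kv]|no] := pselect (X v /\ ~ core v); last first.
    by exists F; split=> [|Xv Kv]; [split|case: no].
  have /existsNP[Y /not_implyP[Yadm /not_implyP[Yv mv]]] :
      ~ forall F', admissible F' -> ~ F' v -> direction F' v.
    by move=> all; apply: Kv; split=> //; exact: XV.2.
  by exists Y.
have [b mb] := direction_nonempty (conj XV FX).
pose X' := X `|` [set b] `|` \bigcup_(v in X) Y v.
have XX' : X `<=` X' by move=> v Xv; left; left.
exists X'; split=> //.
- split; last exact: subset_trans XX'.
  apply: finite_vertex_setU; first apply: finite_vertex_setU => //.
    split; first exact: finite_set1.
    by move=> _ ->; case: (direction_off mb).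
  by apply: finite_vertex_set_bigcup => [|v _]; [exact: XV.1|exact: (YP v).1.1].
- by exists b; split=> //; left; right.
move=> v w Xv Kv mw vw; have [Yadm /(_ Xv Kv)[Yv mv]] := YP v.
have YX' : Y v `<=` X' by move=> z Yz; right; exists v.
have mYw := direction_mono YX' mw; apply: mv.
apply: (direction_linked Yadm _ mYw).
apply: linked_edge (direction_off mYw) _ (adj_sym vw).
by split=> //; exact: XV.2.
Qed.

(** Iterate the previous lemma from a set [X 0] that contains the core. A vertex
    [z] in all the [direction (X n)] cannot exist: a neighbour of [z] outside
    [X 0] lies in no [X n], for it would be cut off at the next stage, and so it
    lies in all the [direction (X n)] too. By connectivity this spreads to
    all of [direction (X 0)], some vertex of which lies in [X 1]. Thus each
    finite set is eventually disjoint from the connected sets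
    [direction (X n)], so the rays with tails in all of them are equivalent,
    although they should have uncountably many ends. *)
Lemma unsplit_absurd : False.
Proof.
have KV : finite_vertex_set G core by split; [exact: core_finite|move=> v []].
pose P (n : nat) X := admissible X /\ core `<=` X.
pose Q (n : nat) X X' := [/\ X `<=` X', direction X `&` X' !=set0
  & forall v w, X v -> ~ core v -> direction X' w -> ~ adj G v w].
have [|n X [Xadm KX]|X [_ XPQ]] := @indexed_dependent_choice _ P Q (core `|` F).
- split; last exact: subsetUl.
  by split; [exact: finite_vertex_setU|exact: subsetUr].
- have [X' [X'adm XX' X'b X'sep]] := direction_separate Xadm KX.
  by exists X'; split; split=> //; exact: subset_trans XX'.
have Xadm n : admissible (X n) by case: (XPQ n) => [[]].
have KX n : core `<=` X n by case: (XPQ n) => [[]].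
have XX i j : i <= j -> X i `<=` X j.
  by apply: subset_chain => n; case: (XPQ n) => _ [].
have direction_vanish z : exists n, ~ direction (X n) z.
  apply/existsNP => mz; have [_ [_ [b [m0b X1b]] _]] := XPQ 0.
  have zb : linked (off (X 0)) z b by exact: direction_class.
  suff m1b : direction (X 1) b by case: (direction_off m1b).
  suff : forall n, direction (X n) b by [].
  elim: zb mz => // {m0b X1b} {}z y {}b X0z zy yb IH mz; apply: IH => n.
  have [Vy nX0y] := linked_left yb.
  have nXy : ~ X n y.
    move=> Xy; have [_ [_ _ /(_ y z Xy)]] := XPQ n.
    by apply; [move/(KX 0)|exact: mz|exact: adj_sym].
  apply: direction_linked (Xadm n) _ (mz n).
  exact: linked_edge (direction_off (mz n)) (conj Vy nXy) zy.
apply: (many_ends_inside_direction Xadm); apply: few_ends_equiv.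
move=> R R' [_ Rdir] [_ R'dir] E [Efin EV].
have [e _|n nP] := finite_eventually (P := fun e n => ~ direction (X n) e) Efin.
  have [n nP] := direction_vanish e; exists n => m nm.
  exact/(contra_not _ nP)/direction_mono/XX.
have {nP}dirNE z : direction (X n) z -> ~ E z.
  by move=> mz Ez; exact: nP (leqnn n) z Ez mz.
have [y my] := direction_nonempty (Xadm n).
have dirE : direction (X n) `<=` linked (off E) y.
  move=> z mz; have yz : linked (off (X n)) y z by exact: direction_class.
  apply: linked_mono (linked_in_class yz) => w yw; split.
    by case: (linked_right yw).
  exact: dirNE (direction_linked (Xadm n) yw my).
exists (class_graph E y); split.
- exact: class_graph_component (linked_right (dirE y my)).
- by have [m Rm] := Rdir n; exists m => i /Rm/dirE.
- by have [m R'm] := R'dir n; exists m => i /R'm/dirE.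
Qed.

End Unsplit.

(** * A binary tree of big components *)

Definition splits F F' v := exists y z,
  [/\ linked (off F) v y, linked (off F) v z, big F' y, big F' z
    & ~ linked (off F') y z].

Lemma big_splits F v : finite_vertex_set G F -> big F v ->
  exists F', [/\ finite_vertex_set G F', F `<=` F' & splits F F' v].
Proof.
move=> FV Fv; apply: contrapT => nosplit; apply: (unsplit_absurd FV Fv).
move=> F' y z [F'V FF'] vy vz F'y F'z; apply: contrapT => yz.
by apply: nosplit; exists F'; split=> //; exists y, z.
Qed.

Lemma splits_refine F F' F'' v : finite_vertex_set G F'' ->
  F `<=` F' -> F' `<=` F'' -> splits F F' v -> splits F F'' v.
Proof.
move=> F''V FF' F'F'' [y [z [vy vz F'y F'z yz]]].
have [y' [yy' F''y']] := big_refine F''V F'F'' F'y.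
have [z' [zz' F''z']] := big_refine F''V F'F'' F'z.
have off' := off_mono FF'; exists y', z'; split=> //.
- exact: linked_trans vy (linked_mono off' yy').
- exact: linked_trans vz (linked_mono off' zz').
move=> yz'; apply: yz; apply: linked_trans yy' _.
exact: linked_trans (linked_mono (off_mono F'F'') yz') (linked_sym zz').
Qed.

Definition reaches F P v w :=
  exists S, [/\ trail S v w, S `<=` off F & S `<=` P].

Lemma reaches_mono F P P' v w :
  P `<=` P' -> reaches F P v w -> reaches F P' v w.
Proof.
by move=> PP' [S [? ? SP]]; exists S; split=> //; exact: subset_trans PP'.
Qed.

(** One level of the tree: all big components in the finite set [L] are split
    by the same finite [F'], and [P'] collects trails to the new
    representatives. [P] holds the trails of the previous level; deleting them
    keeps later trails disjoint from them. *)
Lemma split_level F P L :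
    finite_vertex_set G F -> finite_vertex_set G P -> finite_set L ->
    (forall v, L v -> big F v) ->
  exists F' P' L', [/\ finite_vertex_set G F', finite_vertex_set G P',
      finite_set L' & forall v, L' v -> big F' v] /\
    F `|` P `<=` F' /\
    forall v, L v -> exists y z, [/\ L' y, L' z, reaches F P' v y,
      reaches F P' v z & ~ linked (off F') y z].
Proof.
move=> FV PV Lfin Lbig.
have /choice[E EP] v : exists E, L v ->
    [/\ finite_vertex_set G E, F `<=` E & splits F E v].
  have [Lv|nLv] := pselect (L v); last by exists set0 => /nLv.
  by have [E EP] := big_splits FV (Lbig v Lv); exists E.
pose F' := F `|` P `|` \bigcup_(v in L) E v.
have F'V : finite_vertex_set G F'.
  apply: finite_vertex_setU; first exact: finite_vertex_setU.
  by apply: finite_vertex_set_bigcup => // v /EP[].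
have /choice[W WP] v : exists PL : set T * set T,
    [/\ finite_vertex_set G PL.1, finite_set PL.2, forall w, PL.2 w -> big F' w
      & L v -> exists y z, [/\ PL.2 y, PL.2 z, reaches F PL.1 v y,
          reaches F PL.1 v z & ~ linked (off F') y z]].
  have [Lv|nLv] := pselect (L v); last first.
    exists (set0, set0); split=> //=; first split=> //; exact: finite_set0.
  have [EV FE Esplit] := EP v Lv.
  have EF' : E v `<=` F' by move=> u Eu; right; exists v.
  have [y [z [vy vz F'y F'z yz]]] := splits_refine F'V FE EF' Esplit.
  have [Sy [SyF Sytrail]] := linked_trail vy.
  have [Sz [SzF Sztrail]] := linked_trail vz.
  have SV S w : S `<=` off F -> trail S v w -> finite_vertex_set G S.
    by move=> SF [Sfin _ _ _]; split=> // u /SF[].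
  exists (Sy `|` Sz, [set y; z]); split=> /=.
  - by apply: finite_vertex_setU; [exact: SV Sytrail|exact: SV Sztrail].
  - by rewrite finite_setU; split; exact: finite_set1.
  - by move=> w [->|->].
  move=> _; exists y, z; split=> //; [by left|by right| |].
    by exists Sy; split=> //; exact: subsetUl.
  by exists Sz; split=> //; exact: subsetUr.
exists F', (\bigcup_(v in L) (W v).1), (\bigcup_(v in L) (W v).2).
split; [split=> //|split; first exact: subsetUl].
- by apply: finite_vertex_set_bigcup => // v _; case: (WP v).
- by apply: bigcup_finite => // v _; case: (WP v).
- by move=> w [v _ Ww]; case: (WP v) => _ _ Wbig _; exact: Wbig.
move=> v Lv; have [_ _ _ /(_ Lv)[y [z [Wy Wz vy vz yz]]]] := WP v.
have PW : (W v).1 `<=` \bigcup_(v in L) (W v).1 by move=> u Wu; exists v.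
exists y, z; split=> //; [by exists v|by exists v| |].
  exact: reaches_mono vy.
exact: reaches_mono vz.
Qed.

(** Against the components [C n] selected for the sets [F n.+1] of the tree,
    a branch is chosen that avoids [C n] at level [n.+1], which is possible
    because two children of the same node lie in different components. The ray
    along the trails of the branch stays in its components, hence has no tail
    in any [C n]. *)
Lemma selection_separation_countable : countable (ends G).
Proof.
rewrite endsE; apply: contrapT => Gbig.
have emptyV : finite_vertex_set G set0 by split=> //; exact: finite_set0.
have [x /(contra_not (few_ends_sub (@subIsetr _ _ _))) xbig] :=
  not_few_big emptyV (@subset_refl _ (ray G)) Gbig.
pose P (n : nat) (s : set T * set T * set T) :=
  [/\ finite_vertex_set G s.1.1, finite_vertex_set G s.1.2, finite_set s.2
    & forall v, s.2 v -> big s.1.1 v].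
pose Q (n : nat) (s s' : set T * set T * set T) :=
  s.1.1 `|` s.1.2 `<=` s'.1.1 /\
  forall v, s.2 v -> exists y z, [/\ s'.2 y, s'.2 z, reaches s.1.1 s'.1.2 v y,
    reaches s.1.1 s'.1.2 v z & ~ linked (off s'.1.1) y z].
have [|n [[F E] L] [FV EV Lfin Lbig]|st [st0 stPQ]] :=
    @indexed_dependent_choice _ P Q (set0, set0, [set x]).
- by split=> //; [exact: finite_set1|move=> _ ->].
- have [F' [E' [L' [PF' QF']]]] := split_level FV EV Lfin Lbig.
  by exists (F', E', L').
pose F n := (st n).1.1; pose E n := (st n).1.2; pose L n := (st n).2.
have FV n : finite_vertex_set G (F n) by case: (stPQ n) => -[].
have FE n : F n `|` E n `<=` F n.+1 by case: (stPQ n) => _ [].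
have FS n : F n `<=` F n.+1 by apply: subset_trans (FE n); exact: subsetUl.
have Fmono i j : i <= j -> F i `<=` F j by exact: subset_chain.
have [|C [CF CR]] := sel (F := fun n => F n.+1); first by split.
(* Selection is applied to the shifted sequence since the root of the tree
   offers no alternative. *)
pose R n v w := reaches (F n) (E n.+1) v w /\ ~ vertices (C n) w.
have [|n v Lv|v [v0 vP]] := @indexed_dependent_choice _ L R x.
- by rewrite /L st0.
- have [_ [_ /(_ v Lv)[y [z [Ly Lz vy vz yz]]]]] := stPQ n.
  have [Cy|nCy] := pselect (vertices (C n) y); last by exists y.
  exists z; split=> //; split=> // Cz; apply: yz.
  by rewrite (component_classE (CF n) Cy) in Cz.
have /choice[S SP] n := (vP n).2.1.
have Strail n : trail (S n) (v n) (v n.+1) by case: (SP n).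
have Soff n : S n `<=` off (F n) by case: (SP n).
have Sdisj n m z : n.+2 <= m -> S n z -> ~ S m z.
  move=> nm Sz /Soff[_]; apply; apply: (Fmono _ _ nm).
  by apply: FE; right; case: (SP n) => _ _; exact.
have [Q0 [rayQ0 Q0S]] := ray_along_trails Strail Sdisj.
have [n [N NC]] := CR Q0 rayQ0.
have vlinked m : n < m -> linked (off (F n.+1)) (v n.+1) (v m).
  have Fm k : n < k -> S k `<=` off (F n.+1).
    by move=> nk; apply: subset_trans (Soff k) (off_mono (Fmono _ _ nk)).
  have Sv k : S k (v k) by case: (Strail k).
  elim: m => // m IH; rewrite ltnS leq_eqVlt => /orP[/eqP<-|nm].
    exact/linked_refl/Fm/Sv.
  apply: linked_trans (IH nm) (linked_mono (Fm m nm) _).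
  exact: trail_linked (Strail m) (Sv m).
have [M MS] := Q0S n.+1; have [m [nm SQ0]] := MS _ (leq_maxr N M).
apply: (vP n).2.2; apply: linked_component (CF n) (NC _ (leq_maxl N M)) _.
apply: linked_trans (linked_sym (vlinked m.+1 (leqW nm))).
apply: linked_mono (trail_linked (Strail m) SQ0).
exact: subset_trans (Soff m) (off_mono (Fmono _ _ nm)).
Qed.

End Uncountable.

End Connectivity.

Unset Implicit Arguments.
Set Strict Implicit.

Theorem corollary5p5 (T : Type) (G : graph T) :
  countable (ends G) <->
  (forall F : nat -> set T, increasing_finite G F ->
     exists C : nat -> graph T,
       (forall n, component (delete G (F n)) (C n)) /\
       (forall R, ray G R -> exists n, tail_in R (C n)))
  /\
  (forall R, ray G R ->
     exists F : nat -> set T, increasing_finite G F /\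
       (forall R', ray G R' -> ~ ray_equiv G R R' ->
          exists n, exists C C' : graph T,
            [/\ component (delete G (F n)) C, component (delete G (F n)) C',
                C <> C', tail_in R C & tail_in R' C'])).
Proof.
split=> [Gcountable|[sel sep]].
  split; first exact: countable_ends_selection.
  exact: countable_ends_separation.
exact: selection_separation_countable sel sep.
Qed.
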